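(* Consider FedAvg with partial device participation as described in the context, and let Assumptions (A1)–(A4) hold. Set $\gamma = \max\{8L/\mu,\, E\}$, $\eta_t = \frac{2}{\mu(\gamma+t)}$, $$B = \sum_{k=1}^N p_k^2\sigma_k^2 + 6L\Gamma + 8(E-1)^2 G^2, \qquad C = \frac{4}{K}E^2G^2 .$$ Let $\mathcal{R}$ be an $L_{\mathcal{R}}$-Lipschitz data reconstruction function and $\mathbf{x}$ the private data. Then for every round $t\ge 1$, $$\mathbb{E}\,\|\mathbf{x} - \mathcal{R}(\mathbf{w}_t)\|^2 \;\le\; 2\,\mathbb{E}\,\|\mathbf{x} - \mathcal{R}(\mathbf{w}^\star)\|^2 + \frac{2L_{\mathcal{R}}^2}{\gamma + t}\left( \frac{4(B+C)}{\mu^2} + (\gamma+1)\,\mathbb{E}\,\|\mathbf{w}_1 - \mathbf{w}^\star\|^2 \right).$$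
   Context: Federated setting: there are $N$ devices with weights $p_k \ge 0$, $\sum_{k=1}^N p_k = 1$. Device $k$ holds a finite dataset $D^k$ and has local objective $\mathcal{L}_k(\mathbf{w}) = \frac{1}{n_k}\sum_{j=1}^{n_k} \ell(\mathbf{w}; (\mathbf{x}^k_j, y^k_j))$; for a sample $\xi$ of $D^k$, $\nabla\mathcal{L}_k(\mathbf{w},\xi)$ denotes the stochastic gradient at that sample. The global objective is $\mathcal{L}(\mathbf{w}) = \sum_{k=1}^N p_k \mathcal{L}_k(\mathbf{w})$, with minimizer $\mathbf{w}^\star$ and minimum value $\mathcal{L}^\ast$; $\mathcal{L}_k^\ast$ is the minimum of $\mathcal{L}_k$, and $\Gamma = \mathcal{L}^\ast - \sum_{k=1}^N p_k \mathcal{L}_k^\ast$. FedAvg with partial participation: fix integers $E\ge 1$ and $1\le K \le N$, and let $\mathcal{I}_E = \{nE : n=1,2,\dots\}$. All devices start at a common $\mathbf{w}_1^k = \mathbf{w}_1$. For $t=1,2,\dots$, each device computes $\mathbf{v}^k_{t+1} = \mathbf{w}^k_t - \eta_t \nabla \mathcal{L}_k(\mathbf{w}^k_t, \xi^k_t)$ with $\xi^k_t$ drawn uniformly from $D^k$. If $t+1\notin\mathcal{I}_E$ then $\mathbf{w}^k_{t+1} = \mathbf{v}^k_{t+1}$. If $t+1\in\mathcal{I}_E$, the server draws a multiset $\mathcal{S}_{t+1}$ of $K$ device indices, independently and with replacement according to the distribution $(p_1,\dots,p_N)$, and sets $\mathbf{w}^k_{t+1} = \frac{1}{K}\sum_{j\in\mathcal{S}_{t+1}}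 \mathbf{v}^j_{t+1}$ (counted with multiplicity) for all $k$. The global model is $\mathbf{w}_t = \sum_{k=1}^N p_k \mathbf{w}^k_t$ (which equals the aggregated model at aggregation steps). Assumptions: (A1) each $\mathcal{L}_k$ is $L$-smooth; (A2) each $\mathcal{L}_k$ is $\mu$-strongly convex with $\mu>0$; (A3) $\mathbb{E}\|\nabla\mathcal{L}_k(\mathbf{w}^k_t,\xi^k_t) - \nabla\mathcal{L}_k(\mathbf{w}^k_t)\|^2 \le \sigma_k^2$ for all $k,t$; (A4) $\mathbb{E}\|\nabla\mathcal{L}_k(\mathbf{w}^k_t,\xi^k_t)\|^2 \le G^2$ for all $k,t$. Reconstruction: private data $\mathbf{x}\in[0,1]^d$; $\mathcal{R}$ maps model parameters to $\mathbb{R}^d$, may be randomized with randomness independent of training, and for every realization satisfies $\|\mathcal{R}(\mathbf{v}) - \mathcal{R}(\mathbf{w})\| \le L_{\mathcal{R}}\|\mathbf{v}-\mathbf{w}\|$ for all $\mathbf{v},\mathbf{w}$. Expectations are over all randomness (stochastic gradients, device sampling, and randomness of $\mathcal{R}$). *)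

(* Defs.v *)
From HB Require Import structures.
From mathcomp Require Import all_boot all_order all_algebra.
From mathcomp Require Import all_classical all_reals all_analysis.

Set Implicit Arguments.
Unset Strict Implicit.
Unset Printing Implicit Defensive.

Import Order.TTheory GRing.Theory Num.Theory.
Local Open Scope ring_scope.

(* Model parameters live in 'rV[R]_m, with the Euclidean inner product
   and Euclidean norm (not the sup norm of the library's normed structure). *)
Definition dotv (R : realType) (m : nat) (u v : 'rV[R]_m) : R :=
  \sum_(i < m) u 0 i * v 0 i.

Definition sqn (R : realType) (m : nat) (u : 'rV[R]_m) : R := dotv u u.

Definition enorm (R : realType) (m : nat) (u : 'rV[R]_m) : R := Num.sqrt (sqn u).

Definition is_gradient (R : realType) (m : nat)
    (f : 'rV[R]_m -> R) (gf : 'rV[R]_m -> 'rV[R]_m) : Prop :=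
  forall w, differentiable f w /\ ('d f w = (fun h => dotv (gf w) h) :> ('rV[R]_m -> R)).

Definition smooth (R : realType) (m : nat) (L : R)
    (f : 'rV[R]_m -> R) (gf : 'rV[R]_m -> 'rV[R]_m) : Prop :=
  forall v w, f v <= f w + dotv (v - w) (gf w) + L / 2 * sqn (v - w).

Definition strongly_convex (R : realType) (m : nat) (mu : R)
    (f : 'rV[R]_m -> R) (gf : 'rV[R]_m -> 'rV[R]_m) : Prop :=
  forall v w, f w + dotv (v - w) (gf w) + mu / 2 * sqn (v - w) <= f v.

Definition loc_obj (R : realType) (N m : nat) (X : Type) (n : 'I_N -> nat)
    (D : forall k : 'I_N, 'I_(n k) -> X) (loss : 'rV[R]_m -> X -> R)
    (k : 'I_N) (w : 'rV[R]_m) : R :=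
  (n k)%:R^-1 * \sum_(j < n k) loss w (D k j).

Definition loc_grad (R : realType) (N m : nat) (X : Type) (n : 'I_N -> nat)
    (D : forall k : 'I_N, 'I_(n k) -> X) (sgrad : 'rV[R]_m -> X -> 'rV[R]_m)
    (k : 'I_N) (w : 'rV[R]_m) : 'rV[R]_m :=
  (n k)%:R^-1 *: \sum_(j < n k) sgrad w (D k j).

Definition glob_obj (R : realType) (N m : nat) (X : Type) (n : 'I_N -> nat)
    (D : forall k : 'I_N, 'I_(n k) -> X) (loss : 'rV[R]_m -> X -> R)
    (p : 'I_N -> R) (w : 'rV[R]_m) : R :=
  \sum_(k < N) p k * loc_obj D loss k w.

Definition glob_model (R : realType) (N m : nat) (p : 'I_N -> R)
    (W : 'I_N -> 'rV[R]_m) : 'rV[R]_m :=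
  \sum_(k < N) p k *: W k.

(* One FedAvg step, as a Markov kernel acting on test functions of the
   state (the family of local models).  From state W at time t:
   every device k draws xi_t^k uniformly from D^k (choice c k), computes
   v^k = w^k - eta grad(w^k, xi); if [aggr] (i.e. t+1 is in I_E) the server
   draws K device indices i.i.d. with law p (the map S) and every device
   gets (1/K) sum_j v^{S j}; otherwise w^k_{t+1} = v^k.
   [fed_step ... f W] is the conditional expectation of f(W_{t+1}). *)
Definition fed_step (R : realType) (N m : nat) (X : Type) (n : 'I_N -> nat)
    (D : forall k : 'I_N, 'I_(n k) -> X) (sgrad : 'rV[R]_m -> X -> 'rV[R]_m)
    (p : 'I_N -> R) (K : nat) (eta : R) (aggr : bool)
    (f : ('I_N -> 'rV[R]_m) -> R) (W : 'I_N -> 'rV[R]_m) : R :=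
  \sum_(c : {dffun forall k : 'I_N, 'I_(n k)})
    (\prod_(k < N) (n k)%:R^-1) *
    (let V := fun k => W k - eta *: sgrad (W k) (D k (c k)) in
     if aggr then
       \sum_(S : {ffun 'I_K -> 'I_N})
         (\prod_(j < K) p (S j)) * f (fun _ => K%:R^-1 *: \sum_(j < K) V (S j))
     else f V).

(* [fed_expect ... s r f W] = E[ f(W_{s+r}) | W_s = W ]. *)
Fixpoint fed_expect (R : realType) (N m : nat) (X : Type) (n : 'I_N -> nat)
    (D : forall k : 'I_N, 'I_(n k) -> X) (sgrad : 'rV[R]_m -> X -> 'rV[R]_m)
    (p : 'I_N -> R) (K E : nat) (eta : nat -> R) (s r : nat)
    (f : ('I_N -> 'rV[R]_m) -> R) (W : 'I_N -> 'rV[R]_m) : R :=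
  match r with
  | 0 => f W
  | r'.+1 =>
      fed_step D sgrad p K (eta s) (E %| s.+1)%N
        (fed_expect D sgrad p K E eta s.+1 r' f) W
  end.

Definition fedavg_E (R : realType) (N m : nat) (X : Type) (n : 'I_N -> nat)
    (D : forall k : 'I_N, 'I_(n k) -> X) (sgrad : 'rV[R]_m -> X -> 'rV[R]_m)
    (p : 'I_N -> R) (K E : nat) (eta : nat -> R) (w1 : 'rV[R]_m) (t : nat)
    (f : ('I_N -> 'rV[R]_m) -> R) : R :=
  fed_expect D sgrad p K E eta 1 t.-1 f (fun _ => w1).

(* Main.v *)
(* The convergence bound of Li et al. for FedAvg is combined with
   |x - Rec(w)|^2 <= 2 |x - Rec(wstar)|^2 + 2 LR^2 |w - wstar|^2.

   Two functions of the family W of local models are tracked: the squared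
   distance of the mean model to wstar, and the dispersion
   sum_k p_k |W_k - mean|^2.  A local step contracts the distance by the factor
   1 - eta mu, up to the stochastic noise, the heterogeneity Gamma and twice the
   dispersion.  An aggregation leaves the mean model unbiased, adds 1/K times the
   dispersion to the squared distance and resets the dispersion to zero.  Between
   aggregations the dispersion is at most (j eta G)^2 after j steps of size at
   most eta: by Young's inequality with parameter j,
   (1 + 1/j) j^2 + (1 + j) = (j + 1)^2.  This only needs the law of the current
   state, not of the whole trajectory. *)
Require Import Defs.
From HB Require Import structures.
From mathcomp Require Import all_boot all_order all_algebra.
From mathcomp Require Import all_classical all_reals all_analysis.
From mathcomp Require Import measurable_realfun ring lra.

Import Order.TTheory GRing.Theory Num.Theory.
Local Open Scope ring_scope.

Set Implicit Arguments.
Unset Strict Implicit.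
Unset Printing Implicit Defensive.

(** * Euclidean inner product and squared norm *)

Lemma dotvC (R : realType) (m : nat) (u v : 'rV[R]_m) : dotv u v = dotv v u.
Proof. by apply: eq_bigr => i _; rewrite mulrC. Qed.

Lemma dotvDr (R : realType) (m : nat) (u v w : 'rV[R]_m) :
  dotv u (v + w) = dotv u v + dotv u w.
Proof. by rewrite -big_split; apply: eq_bigr => i _; rewrite mxE mulrDr. Qed.

Lemma dotvZr (R : realType) (m : nat) (a : R) (u v : 'rV[R]_m) :
  dotv u (a *: v) = a * dotv u v.
Proof. by rewrite mulr_sumr; apply: eq_bigr => i _; rewrite mxE mulrCA. Qed.

Lemma dotv0r (R : realType) (m : nat) (u : 'rV[R]_m) : dotv u 0 = 0.
Proof. by apply: big1 => i _; rewrite mxE mulr0. Qed.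

Lemma dotvNr (R : realType) (m : nat) (u v : 'rV[R]_m) : dotv u (- v) = - dotv u v.
Proof. by rewrite -scaleN1r dotvZr mulN1r. Qed.

Lemma dotvDl (R : realType) (m : nat) (u v w : 'rV[R]_m) :
  dotv (v + w) u = dotv v u + dotv w u.
Proof. by rewrite !(dotvC _ u) dotvDr. Qed.

Lemma dotvZl (R : realType) (m : nat) (a : R) (u v : 'rV[R]_m) :
  dotv (a *: v) u = a * dotv v u.
Proof. by rewrite !(dotvC _ u) dotvZr. Qed.

Lemma dotvNl (R : realType) (m : nat) (u v : 'rV[R]_m) : dotv (- v) u = - dotv v u.
Proof. by rewrite !(dotvC _ u) dotvNr. Qed.

Lemma dotv_sumr (R : realType) (m : nat) (I : Type) (r : seq I) (Q : pred I)
    (u : 'rV[R]_m) (v : I -> 'rV[R]_m) :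
  dotv u (\sum_(i <- r | Q i) v i) = \sum_(i <- r | Q i) dotv u (v i).
Proof. by apply: (big_morph _ (dotvDr u) (dotv0r u)). Qed.

Lemma dotv_suml (R : realType) (m : nat) (I : Type) (r : seq I) (Q : pred I)
    (u : 'rV[R]_m) (v : I -> 'rV[R]_m) :
  dotv (\sum_(i <- r | Q i) v i) u = \sum_(i <- r | Q i) dotv (v i) u.
Proof. by rewrite dotvC dotv_sumr; apply: eq_bigr => i _; rewrite dotvC. Qed.

Lemma sqn_ge0 (R : realType) (m : nat) (u : 'rV[R]_m) : 0 <= sqn u.
Proof. by apply: sumr_ge0 => i _; rewrite -expr2 sqr_ge0. Qed.

Lemma sqn0 (R : realType) (m : nat) : sqn (0 : 'rV[R]_m) = 0.
Proof. exact: dotv0r. Qed.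

Lemma sqnN (R : realType) (m : nat) (u : 'rV[R]_m) : sqn (- u) = sqn u.
Proof. by rewrite /sqn dotvNl dotvNr opprK. Qed.

Lemma sqnZ (R : realType) (m : nat) (a : R) (u : 'rV[R]_m) :
  sqn (a *: u) = a ^+ 2 * sqn u.
Proof. by rewrite /sqn dotvZl dotvZr mulrA expr2. Qed.

Lemma sqnD (R : realType) (m : nat) (u v : 'rV[R]_m) :
  sqn (u + v) = sqn u + 2 * dotv u v + sqn v.
Proof. by rewrite /sqn !dotvDl !dotvDr (dotvC v u); ring. Qed.

(** Expand [0 <= sqn (a *: u - v)] and divide by [a]. *)
Lemma dotv_young (R : realType) (m : nat) (a : R) (u v : 'rV[R]_m) :
  0 < a -> 2 * dotv u v <= a * sqn u + a^-1 * sqn v.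
Proof.
move=> a0; have := sqn_ge0 (a *: u - v).
rewrite sqnD sqnZ sqnN dotvZl dotvNr => h.
rewrite -subr_ge0 -(pmulr_rge0 _ a0).
suff -> : a * (a * sqn u + a^-1 * sqn v - 2 * dotv u v) =
          a ^+ 2 * sqn u + 2 * (a * - dotv u v) + sqn v by [].
by field; rewrite gt_eqF.
Qed.

Lemma sqnD_young (R : realType) (m : nat) (a : R) (u v : 'rV[R]_m) :
  0 < a -> sqn (u + v) <= (1 + a^-1) * sqn u + (1 + a) * sqn v.
Proof.
move=> a0; rewrite sqnD dotvC; have := dotv_young v u a0; lra.
Qed.

(** Provides the test vector for comparing [mu] with [L]; in dimension 0 there is none, hence the
    later case split. *)
Lemma sqn_gt0_ex (R : realType) (m : nat) : (0 < m)%N -> exists u : 'rV[R]_m, 0 < sqn u.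
Proof.
case: m => // m _; exists (delta_mx 0 ord0).
rewrite /sqn /dotv (bigD1 ord0) //= mxE !eqxx mulr1 ltr_wpDr //.
by apply: sumr_ge0 => i _; rewrite -expr2 sqr_ge0.
Qed.

Lemma rV_eq_dim0 (R : realType) (m : nat) (u v : 'rV[R]_m) : m = 0%N -> u = v.
Proof. by move=> m0; subst m; apply/rowP => -[]. Qed.

(** * Weighted mean of the local models and dispersion around it *)

Definition dispersion (R : realType) (N m : nat) (p : 'I_N -> R)
    (W : 'I_N -> 'rV[R]_m) : R :=
  \sum_(k < N) p k * sqn (W k - glob_model p W).

Lemma dispersion_ge0 (R : realType) (N m : nat) (p : 'I_N -> R)
    (W : 'I_N -> 'rV[R]_m) : (forall k, 0 <= p k) -> 0 <= dispersion p W.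
Proof. by move=> p0; apply: sumr_ge0 => k _; rewrite mulr_ge0 ?sqn_ge0. Qed.

Lemma glob_model_cst (R : realType) (N m : nat) (p : 'I_N -> R) (w : 'rV[R]_m) :
  \sum_(k < N) p k = 1 -> glob_model p (fun=> w) = w.
Proof. by move=> p1; rewrite /glob_model -scaler_suml p1 scale1r. Qed.

Lemma glob_modelB (R : realType) (N m : nat) (p : 'I_N -> R) (a : R)
    (W H : 'I_N -> 'rV[R]_m) :
  glob_model p (fun k => W k - a *: H k) = glob_model p W - a *: glob_model p H.
Proof.
rewrite /glob_model scaler_sumr -sumrB; apply: eq_bigr => k _.
by rewrite scalerBr !scalerA mulrC.
Qed.

Lemma glob_modelBcst (R : realType) (N m : nat) (p : 'I_N -> R)
    (W : 'I_N -> 'rV[R]_m) (z : 'rV[R]_m) : \sum_(k < N) p k = 1 ->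
  \sum_(k < N) p k *: (W k - z) = glob_model p W - z.
Proof.
move=> p1; rewrite -[z in RHS](@glob_model_cst _ _ _ p z) // /glob_model -sumrB.
by apply: eq_bigr => k _; rewrite scalerBr.
Qed.

(** Parallel axis identity: the cross term vanishes because the deviations from the weighted mean
    average to zero. At [z = 0] it yields both Jensen's inequality for [sqn] and the bound of a
    variance by the second moment. *)
Lemma wsum_sqn_dispersion (R : realType) (N m : nat) (p : 'I_N -> R)
    (W : 'I_N -> 'rV[R]_m) (z : 'rV[R]_m) : \sum_(k < N) p k = 1 ->
  \sum_(k < N) p k * sqn (W k - z) = sqn (glob_model p W - z) + dispersion p W.
Proof.
move=> p1; set g := glob_model p W.
have E k : p k * sqn (W k - z) =
    (p k * sqn (g - z) + 2 * dotv (g - z) (p k *: (W k - g))) + p k * sqn (W k - g).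
  have -> : W k - z = (g - z) + (W k - g) by rewrite [RHS]addrC addrA addrNK.
  by rewrite sqnD dotvZr; ring.
rewrite (eq_bigr _ (fun k _ => E k)) !big_split /= -mulr_suml p1 mul1r.
by rewrite -mulr_sumr -dotv_sumr glob_modelBcst // subrr dotv0r mulr0 addr0.
Qed.

Lemma dispersion_cst (R : realType) (N m : nat) (p : 'I_N -> R) (w : 'rV[R]_m) :
  \sum_(k < N) p k = 1 -> dispersion p (fun=> w) = 0.
Proof.
by move=> p1; apply: big1 => k _; rewrite glob_model_cst // subrr sqn0 mulr0.
Qed.

(** The deviation of device [k] moves by [- eta] times the deviation of [H k]. Young's inequality is
    applied device by device, and the dispersion of [H] is then bounded by its second moment. *)
Lemma dispersion_step (R : realType) (N m : nat) (p : 'I_N -> R) (a eta : R)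
    (W H : 'I_N -> 'rV[R]_m) :
  (forall k, 0 <= p k) -> \sum_(k < N) p k = 1 -> 0 < a ->
  dispersion p (fun k => W k - eta *: H k) <=
  (1 + a^-1) * dispersion p W + (1 + a) * (eta ^+ 2 * \sum_(k < N) p k * sqn (H k)).
Proof.
move=> p0 p1 a0.
have HH : dispersion p H <= \sum_(k < N) p k * sqn (H k).
  under [X in _ <= X]eq_bigr => k _ do rewrite -[H k]subr0.
  by rewrite wsum_sqn_dispersion // lerDr sqn_ge0.
apply: (@le_trans _ _ ((1 + a^-1) * dispersion p W
                       + (1 + a) * (eta ^+ 2 * dispersion p H))); last first.
  rewrite lerD2l; apply: ler_wpM2l; first by rewrite addr_ge0 ?ltW.
  by apply: ler_wpM2l; rewrite ?sqr_ge0.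
rewrite /dispersion glob_modelB !mulr_sumr -big_split /=; apply: ler_sum => k _.
have -> : W k - eta *: H k - (glob_model p W - eta *: glob_model p H) =
    (W k - glob_model p W) + (- eta) *: (H k - glob_model p H).
  by rewrite scaleNr scalerBr !opprD !opprK addrACA.
have := sqnD_young (W k - glob_model p W) (- eta *: (H k - glob_model p H)) a0.
rewrite sqnZ sqrrN => /(ler_wpM2l (p0 k)) /le_trans; apply.
lra.
Qed.

(** * Descent inequalities for a step along the full gradients *)

(** The quadratic upper bound at [w] is smallest at [w - L^-1 *: gf w], where it equals
    [f w - sqn (gf w) / (2 * L)]; this still dominates [fmin]. *)
Lemma smooth_sqn_grad (R : realType) (m : nat) (L : R) (f : 'rV[R]_m -> R)
    (gf : 'rV[R]_m -> 'rV[R]_m) (fmin : R) (w : 'rV[R]_m) :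
  0 < L -> smooth L f gf -> (forall v, fmin <= f v) ->
  sqn (gf w) <= 2 * L * (f w - fmin).
Proof.
move=> L0 sm fm; have := sm (w - L^-1 *: gf w) w.
have -> : w - L^-1 *: gf w - w = (- L^-1) *: gf w by rewrite addrC addKr scaleNr.
rewrite dotvZl sqnZ -/(sqn (gf w)) => h.
have {h} := le_trans (fm _) h.
have -> : f w + - L^-1 * sqn (gf w) + L / 2 * ((- L^-1) ^+ 2 * sqn (gf w)) =
          f w - (2 * L)^-1 * sqn (gf w) by field; rewrite gt_eqF.
move=> h; rewrite -subr_ge0.
have -> : 2 * L * (f w - fmin) - sqn (gf w) =
          (2 * L) * (f w - (2 * L)^-1 * sqn (gf w) - fmin).
  by field; rewrite gt_eqF.
by apply: mulr_ge0; [rewrite mulr_ge0 ?ltW | rewrite subr_ge0].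
Qed.

(** The inner product is split at [w]: the part along [wbar - w] goes to Young's inequality, the
    part along [w - z] to strong convexity. The last term is kept because [f wbar - f z] has no sign
    for a single device; it gets one only after averaging over all devices. *)
Lemma local_descent (R : realType) (m : nat) (L mu eta : R) (f : 'rV[R]_m -> R)
    (gf : 'rV[R]_m -> 'rV[R]_m) (fmin : R) (wbar w z : 'rV[R]_m) :
  0 < L -> 0 < mu -> 0 < eta -> eta * L <= 1 / 4 ->
  smooth L f gf -> strongly_convex mu f gf -> (forall v, fmin <= f v) ->
  - 2 * eta * dotv (wbar - z) (gf w) + eta ^+ 2 * sqn (gf w) <=
  - (eta * mu) * sqn (w - z) + 2 * sqn (w - wbar)
  + 6 * eta ^+ 2 * L * (f z - fmin)
  - 2 * eta * (1 - 2 * L * eta) * (1 - eta * L) * (f wbar - f z).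
Proof.
move=> L0 mu0 eta0 etaL sm sc fm.
have y1 : - 2 * eta * dotv (wbar - w) (gf w) <=
    sqn (w - wbar) + eta ^+ 2 * sqn (gf w).
  have := sqn_ge0 ((wbar - w) + eta *: gf w).
  rewrite sqnD sqnZ dotvZr -(sqnN (wbar - w)) opprB; lra.
have c1 : - 2 * eta * dotv (w - z) (gf w) <=
    - 2 * eta * (f w - f z) - eta * mu * sqn (w - z).
  have := sc z w; rewrite -(opprB w z) dotvNl sqnN -subr_ge0.
  move/(mulr_ge0 (ltW eta0)); lra.
have s1 := smooth_sqn_grad w L0 sm fm.
have s2 := smooth_sqn_grad wbar L0 sm fm.
(* Transfers the function value from [w] to [wbar]: convexity at [wbar], then Young's inequality
   with parameter [eta], then [s2]. *)
have lin : f wbar - eta * L * (f wbar - fmin) - (2 * eta)^-1 * sqn (w - wbar) <= f w.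
  have := sc w wbar; have mq : 0 <= mu / 2 * sqn (w - wbar).
    by rewrite mulr_ge0 ?sqn_ge0 // divr_ge0 ?ltW.
  have := dotv_young (gf wbar) (- (w - wbar)) eta0.
  rewrite dotvNr sqnN (dotvC (gf wbar)).
  have /(ler_wpM2l (ltW eta0)) := s2.
  have -> : (2 * eta)^-1 = eta^-1 / 2 by field; rewrite gt_eqF.
  move: mq; generalize (eta^-1) => i; lra.
have split : dotv (wbar - z) (gf w) = dotv (wbar - w) (gf w) + dotv (w - z) (gf w).
  by rewrite -dotvDl addrA addrNK.
(* Coefficient of [f w - f z] once [2 * eta ^+ 2 * sqn (gf w)] is bounded through [s1] and
   [f w - fmin] is split at [f z]. The condition [eta * L <= 1 / 4] makes it nonnegative. *)
set gam := 2 * eta * (1 - 2 * L * eta).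
have gam0 : 0 <= gam by rewrite /gam; nra.
have h1 := ler_wpM2l gam0 lin.
have h2 : gam * ((2 * eta)^-1 * sqn (w - wbar)) <= sqn (w - wbar).
  have -> : gam * ((2 * eta)^-1 * sqn (w - wbar)) = (1 - 2 * L * eta) * sqn (w - wbar).
    by rewrite /gam; field; rewrite gt_eqF.
  by rewrite ler_piMl ?sqn_ge0 //; nra.
have h3 := ler_wpM2l (sqr_ge0 eta) s1.
(* The 6 is 4 from the squared gradient at [w] plus at most 2 from the value transfer in [lin]. *)
have h4 : (4 * L * eta ^+ 2 + gam * (eta * L)) * (f z - fmin) <=
          6 * eta ^+ 2 * L * (f z - fmin).
  rewrite ler_wpM2r ?subr_ge0 ?fm // /gam.
  have : 0 <= eta ^+ 2 * L ^+ 2 * eta by rewrite !mulr_ge0 ?sqr_ge0 ?ltW.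
  by lra.
rewrite split; move: h1 h2 h3 h4; rewrite /gam; lra.
Qed.

(** Average of [local_descent] over the devices with [wbar] the mean model. The contraction term is
    turned from the local models to the mean model by [wsum_sqn_dispersion], whose extra dispersion
    has a favourable sign. *)
Lemma global_descent (R : realType) (N m : nat) (p : 'I_N -> R) (L mu eta : R)
    (f : 'I_N -> 'rV[R]_m -> R) (gf : 'I_N -> 'rV[R]_m -> 'rV[R]_m)
    (fmin : 'I_N -> R) (z : 'rV[R]_m) (W : 'I_N -> 'rV[R]_m) :
  (forall k, 0 <= p k) -> \sum_(k < N) p k = 1 ->
  0 < L -> 0 < mu -> 0 < eta -> eta * L <= 1 / 4 ->
  (forall k, smooth L (f k) (gf k)) -> (forall k, strongly_convex mu (f k) (gf k)) ->
  (forall k v, fmin k <= f k v) ->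
  (forall v, \sum_(k < N) p k * f k z <= \sum_(k < N) p k * f k v) ->
  sqn (glob_model p W - eta *: glob_model p (fun k => gf k (W k)) - z) <=
  (1 - eta * mu) * sqn (glob_model p W - z) + 2 * dispersion p W
  + 6 * eta ^+ 2 * L * (\sum_(k < N) p k * f k z - \sum_(k < N) p k * fmin k).
Proof.
move=> p0 p1 L0 mu0 eta0 etaL sm sc fm zmin.
set g := glob_model p W; set gb := glob_model p _.
have jensen : sqn gb <= \sum_(k < N) p k * sqn (gf k (W k)).
  under eq_bigr => k _ do rewrite -[gf k (W k)]subr0.
  by rewrite wsum_sqn_dispersion // subr0 lerDl dispersion_ge0.
have step : sqn (g - eta *: gb - z) = sqn (g - z)
    + (- 2 * eta * dotv (g - z) gb + eta ^+ 2 * sqn gb).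
  have -> : g - eta *: gb - z = (g - z) + (- eta) *: gb by rewrite scaleNr addrAC.
  by rewrite [LHS]sqnD sqnZ dotvZr; ring.
have dE : dotv (g - z) gb = \sum_(k < N) p k * dotv (g - z) (gf k (W k)).
  by rewrite dotv_sumr; apply: eq_bigr => k _; rewrite dotvZr.
have loc : \sum_(k < N) p k * (- 2 * eta * dotv (g - z) (gf k (W k))
    + eta ^+ 2 * sqn (gf k (W k)))
   <= \sum_(k < N) p k * (- (eta * mu) * sqn (W k - z) + 2 * sqn (W k - g)
  + 6 * eta ^+ 2 * L * (f k z - fmin k)
  - 2 * eta * (1 - 2 * L * eta) * (1 - eta * L) * (f k g - f k z)).
  by apply: ler_sum => k _; apply: ler_wpM2l => //; apply: local_descent.
have locE : \sum_(k < N) p k * (- (eta * mu) * sqn (W k - z) + 2 * sqn (W k - g)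
  + 6 * eta ^+ 2 * L * (f k z - fmin k)
  - 2 * eta * (1 - 2 * L * eta) * (1 - eta * L) * (f k g - f k z)) =
  - (eta * mu) * (sqn (g - z) + dispersion p W) + 2 * dispersion p W
  + 6 * eta ^+ 2 * L * (\sum_(k < N) p k * f k z - \sum_(k < N) p k * fmin k)
  - 2 * eta * (1 - 2 * L * eta) * (1 - eta * L) *
    (\sum_(k < N) p k * f k g - \sum_(k < N) p k * f k z).
  rewrite -wsum_sqn_dispersion // /dispersion -!sumrB !mulr_sumr -!big_split -sumrB /=.
  by apply: eq_bigr => k _; ring.
have gE : \sum_(k < N) p k * (- 2 * eta * dotv (g - z) (gf k (W k))
    + eta ^+ 2 * sqn (gf k (W k)))
   = - 2 * eta * dotv (g - z) gb + eta ^+ 2 * \sum_(k < N) p k * sqn (gf k (W k)).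
  by rewrite dE !mulr_sumr -big_split /=; apply: eq_bigr => k _; ring.
have e1 := ler_wpM2l (sqr_ge0 eta) jensen.
(* Here the minimality of [z] for the weighted sum gives the function gap its sign. *)
have e2 : 0 <= 2 * eta * (1 - 2 * L * eta) * (1 - eta * L) *
    (\sum_(k < N) p k * f k g - \sum_(k < N) p k * f k z).
  rewrite mulr_ge0 ?subr_ge0 //; rewrite !mulr_ge0 ?subr_ge0 ?ltW //; nra.
have e3 : 0 <= eta * mu * dispersion p W by rewrite !mulr_ge0 ?dispersion_ge0 ?ltW.
rewrite step; move: loc; rewrite locE gE; lra.
Qed.

(** * Finite expectations and independent coordinates *)

Definition wmean (R : realType) (T : finType) (q : T -> R) (f : T -> R) : R :=
  \sum_x q x * f x.

Lemma eq_wmean (R : realType) (T : finType) (q f g : T -> R) :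
  f =1 g -> wmean q f = wmean q g.
Proof. by move=> fg; apply: eq_bigr => x _; rewrite fg. Qed.

Lemma wmeanD (R : realType) (T : finType) (q f g : T -> R) :
  wmean q (fun x => f x + g x) = wmean q f + wmean q g.
Proof. by rewrite -big_split; apply: eq_bigr => x _; rewrite mulrDr. Qed.

Lemma wmeanZ (R : realType) (T : finType) (q : T -> R) (a : R) (f : T -> R) :
  wmean q (fun x => a * f x) = a * wmean q f.
Proof. by rewrite mulr_sumr; apply: eq_bigr => x _; rewrite mulrCA. Qed.

Lemma wmean_sum (R : realType) (T : finType) (q : T -> R) (I : finType) (f : I -> T -> R) :
  wmean q (fun x => \sum_i f i x) = \sum_i wmean q (f i).
Proof. by rewrite exchange_big; apply: eq_bigr => x _; rewrite mulr_sumr. Qed.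

Lemma wmean_cst (R : realType) (T : finType) (q : T -> R) (a : R) :
  \sum_x q x = 1 -> wmean q (fun=> a) = a.
Proof. by move=> q1; rewrite /wmean -mulr_suml q1 mul1r. Qed.

Lemma le_wmean (R : realType) (T : finType) (q f g : T -> R) :
  (forall x, 0 <= q x) -> (forall x, f x <= g x) -> wmean q f <= wmean q g.
Proof. by move=> q0 fg; apply: ler_sum => x _; rewrite ler_wpM2l. Qed.

(* [c i] has law [q i] and the coordinates are independent. *)
Definition product_law (R : realType) (O : finType) (P : O -> R) (I : finType)
    (T : I -> finType) (q : forall i, T i -> R) (c : forall i, O -> T i) : Prop :=
  forall F : forall i, T i -> R,
    wmean P (fun o => \prod_i F i (c i o)) = \prod_i wmean (q i) (F i).

(** Take [F] equal to [f i] at coordinate [i] and to 1 elsewhere; the other factors are total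
    masses. *)
Lemma product_law_mean1 (R : realType) (O : finType) (P : O -> R) (I : finType)
    (T : I -> finType) (q : forall i, T i -> R) (c : forall i, O -> T i) (i : I)
    (f : forall i, T i -> R) :
  product_law P q c -> (forall i, \sum_j q i j = 1) ->
  wmean P (fun o => f i (c i o)) = wmean (q i) (f i).
Proof.
move=> ind q1; have := ind (fun l j => if l == i then f l j else 1).
rewrite [RHS](bigD1 i) //= [X in _ * X]big1 ?mulr1 => [|l /negbTE li]; last first.
  by rewrite li; exact: wmean_cst.
rewrite eqxx => <-; apply: eq_wmean => o.
by rewrite (bigD1 i) //= eqxx big1 ?mulr1 // => l /negbTE ->.
Qed.

Lemma product_law_mean2 (R : realType) (O : finType) (P : O -> R) (I : finType)
    (T : I -> finType) (q : forall i, T i -> R) (c : forall i, O -> T i) (i l : I)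
    (f g : forall i, T i -> R) :
  product_law P q c -> (forall i, \sum_j q i j = 1) -> i != l ->
  wmean P (fun o => f i (c i o) * g l (c l o)) = wmean (q i) (f i) * wmean (q l) (g l).
Proof.
move=> ind q1 il.
have := ind (fun h j => if h == i then f h j else if h == l then g h j else 1).
have li : l != i by rewrite eq_sym.
rewrite [RHS](bigD1 i) //= [X in _ * X](bigD1 l) //= [X in _ * (_ * X)]big1; last first.
  by move=> h /andP[/negbTE-> /negbTE->]; exact: wmean_cst.
rewrite mulr1 !eqxx (negbTE li) => <-; apply: eq_wmean => o.
rewrite (bigD1 i) //= eqxx (bigD1 l) //= (negbTE li) eqxx big1 ?mulr1 //.
by move=> h /andP[/negbTE-> /negbTE->].
Qed.

(** Variances of independent centred vectors add up: all cross terms have mean zero. It serves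
    twice, for the gradient noise of the devices and for the device sampling. *)
Lemma product_law_variance (R : realType) (O : finType) (P : O -> R) (I : finType)
    (T : I -> finType) (q : forall i, T i -> R) (c : forall i, O -> T i) (m : nat)
    (y : forall i, T i -> 'rV[R]_m) (u : 'rV[R]_m) :
  product_law P q c -> \sum_o P o = 1 -> (forall i, \sum_j q i j = 1) ->
  (forall i, \sum_j q i j *: y i j = 0) ->
  wmean P (fun o => sqn (u + \sum_i y i (c i o))) =
  sqn u + \sum_i wmean (q i) (fun j => sqn (y i j)).
Proof.
move=> ind P1 q1 y0.
have dot0 i v : wmean (q i) (fun j => dotv v (y i j)) = 0.
  rewrite /wmean; under eq_bigr => j _ do rewrite -dotvZr.
  by rewrite -dotv_sumr y0 dotv0r.
have coord0 i (a : 'I_m) : wmean (q i) (fun j => y i j 0 a) = 0.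
  transitivity ((\sum_j q i j *: y i j) 0 a); last by rewrite y0 mxE.
  by rewrite summxE; apply: eq_bigr => j _; rewrite mxE.
have E o : sqn (u + \sum_i y i (c i o)) =
    sqn u + 2 * (\sum_i dotv u (y i (c i o)))
    + \sum_i \sum_l dotv (y i (c i o)) (y l (c l o)).
  rewrite sqnD dotv_sumr {2}/sqn dotv_suml; congr (_ + _).
  by apply: eq_bigr => i _; rewrite dotv_sumr.
rewrite (eq_wmean _ E) !wmeanD wmean_cst // wmeanZ !wmean_sum.
rewrite [X in 2 * X]big1 => [|i _]; last first.
  by rewrite (@product_law_mean1 _ _ _ _ _ q c i (fun i j => dotv u (y i j))).
rewrite mulr0 addr0; congr (_ + _); apply: eq_bigr => i _.
rewrite wmean_sum (bigD1 i) //= [X in _ + X]big1 ?addr0 => [|l li]; last first.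
  (* Independence is stated for scalar factors, so the inner product of two distinct terms is
     treated coordinate by coordinate. *)
  rewrite /dotv wmean_sum big1 // => a _.
  rewrite (@product_law_mean2 _ _ _ _ _ q c i l (fun i j => y i j 0 a)
             (fun i j => y i j 0 a)) // 1?eq_sym //.
  by rewrite !coord0 mulr0.
by rewrite (@product_law_mean1 _ _ _ _ _ q c i (fun i j => sqn (y i j))).
Qed.

(** Distributivity for dependent functions: each [T i] is viewed as the elements of tag [i] in the
    disjoint union, where the law for ordinary functions applies, and the result is carried back
    along the bijection with [fprod]. *)
Lemma bigA_distr_dffun (R : realType) (I : finType) (T : I -> finType)
    (F : forall i, T i -> R) :
  \sum_(c : {dffun forall i, T i}) \prod_i F i (c i) = \prod_i \sum_j F i j.
Proof.
rewrite (reindex (@dffun_of_fprod _ T)) /=; last exact/onW_bij/dffun_of_fprod_bij.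
under [RHS]eq_bigr => i _ do rewrite (big_tag F i).
rewrite bigA_distr_big_dep /=.
transitivity (\sum_(t : fprod T) \prod_(i in I) [ffun j => F i j] (t i)).
  by apply: eq_bigr => t _; apply: eq_bigr => i _; rewrite !ffunE.
rewrite (@big_fprod R 0 1 _ _ I T (fun i => [ffun j => F i j])) /=.
apply: eq_bigr => g _; apply: eq_bigr => i _.
by rewrite /untag; case: eqP => // e; rewrite ffunE.
Qed.

Lemma product_law_dffun (R : realType) (I : finType) (T : I -> finType)
    (q : forall i, T i -> R) :
  product_law (fun c : {dffun forall i, T i} => \prod_i q i (c i)) q (fun i c => c i).
Proof.
move=> F; rewrite /wmean -bigA_distr_dffun.
by apply: eq_bigr => c _; rewrite -big_split.
Qed.

Lemma product_law_ffun (R : realType) (I T : finType) (q : T -> R) :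
  @product_law R _ (fun c : {ffun I -> T} => \prod_i q (c i)) I (fun=> T)
    (fun=> q) (fun i c => c i).
Proof.
move=> F; rewrite /wmean bigA_distr_bigA.
by apply: eq_bigr => c _; rewrite -big_split.
Qed.

Lemma sum_prod_ffun (R : realType) (I T : finType) (q : T -> R) :
  \sum_x q x = 1 -> \sum_(c : {ffun I -> T}) \prod_i q (c i) = 1.
Proof.
move=> q1; rewrite -(bigA_distr_bigA (fun=> q)) big1 // => i _; exact: q1.
Qed.

Lemma sum_invn (R : realType) (n : nat) : (0 < n)%N -> \sum_(j < n) n%:R^-1 = 1 :> R.
Proof.
by move=> n0; rewrite sumr_const card_ord -[LHS]mulr_natl divff // pnatr_eq0 -lt0n.
Qed.

Lemma sum_prod_invn (R : realType) (N : nat) (n : 'I_N -> nat) :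
  (forall k, 0 < n k)%N ->
  \sum_(c : {dffun forall k : 'I_N, 'I_(n k)}) \prod_(k < N) (n k)%:R^-1 = 1 :> R.
Proof.
move=> n0; rewrite (@bigA_distr_dffun R _ _ (fun k (j : 'I_(n k)) => (n k)%:R^-1)).
by rewrite big1 // => k _; rewrite sum_invn.
Qed.

(** * Conditional expectations over one step *)

Definition local_steps (R : realType) (N m : nat) (X : Type) (n : 'I_N -> nat)
    (D : forall k : 'I_N, 'I_(n k) -> X) (sgrad : 'rV[R]_m -> X -> 'rV[R]_m)
    (eta : R) (W : 'I_N -> 'rV[R]_m) (c : {dffun forall k : 'I_N, 'I_(n k)}) :
    'I_N -> 'rV[R]_m :=
  fun k => W k - eta *: sgrad (W k) (D k (c k)).

(** Reading the kernel as nested finite means lets the facts on [wmean] be applied to it layer by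
    layer. *)
Lemma fed_stepE (R : realType) (N m : nat) (X : Type) (n : 'I_N -> nat)
    (D : forall k : 'I_N, 'I_(n k) -> X) (sgrad : 'rV[R]_m -> X -> 'rV[R]_m)
    (p : 'I_N -> R) (K : nat) (eta : R) (aggr : bool)
    (f : ('I_N -> 'rV[R]_m) -> R) (W : 'I_N -> 'rV[R]_m) :
  fed_step D sgrad p K eta aggr f W =
  wmean (fun=> \prod_(k < N) (n k)%:R^-1) (fun c =>
    if aggr then
      wmean (fun S : {ffun 'I_K -> 'I_N} => \prod_(j < K) p (S j))
        (fun S => f (fun=> K%:R^-1 *: \sum_(j < K) local_steps D sgrad eta W c (S j)))
    else f (local_steps D sgrad eta W c)).
Proof. by []. Qed.

Lemma fed_stepD (R : realType) (N m : nat) (X : Type) (n : 'I_N -> nat)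
    (D : forall k : 'I_N, 'I_(n k) -> X) (sgrad : 'rV[R]_m -> X -> 'rV[R]_m)
    (p : 'I_N -> R) (K : nat) (eta : R) (aggr : bool)
    (f g : ('I_N -> 'rV[R]_m) -> R) (W : 'I_N -> 'rV[R]_m) :
  fed_step D sgrad p K eta aggr (fun V => f V + g V) W =
  fed_step D sgrad p K eta aggr f W + fed_step D sgrad p K eta aggr g W.
Proof.
rewrite !fed_stepE -wmeanD; apply: eq_wmean => c.
by case: aggr; rewrite ?wmeanD.
Qed.

Lemma fed_stepZ (R : realType) (N m : nat) (X : Type) (n : 'I_N -> nat)
    (D : forall k : 'I_N, 'I_(n k) -> X) (sgrad : 'rV[R]_m -> X -> 'rV[R]_m)
    (p : 'I_N -> R) (K : nat) (eta : R) (aggr : bool) (a : R)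
    (f : ('I_N -> 'rV[R]_m) -> R) (W : 'I_N -> 'rV[R]_m) :
  fed_step D sgrad p K eta aggr (fun V => a * f V) W =
  a * fed_step D sgrad p K eta aggr f W.
Proof.
rewrite !fed_stepE -wmeanZ; apply: eq_wmean => c.
by case: aggr; rewrite ?wmeanZ.
Qed.

Lemma fed_step_cst (R : realType) (N m : nat) (X : Type) (n : 'I_N -> nat)
    (D : forall k : 'I_N, 'I_(n k) -> X) (sgrad : 'rV[R]_m -> X -> 'rV[R]_m)
    (p : 'I_N -> R) (K : nat) (eta : R) (aggr : bool) (a : R)
    (W : 'I_N -> 'rV[R]_m) :
  (forall k, 0 < n k)%N -> \sum_(k < N) p k = 1 ->
  fed_step D sgrad p K eta aggr (fun=> a) W = a.
Proof.
move=> n0 p1; rewrite fed_stepE -[RHS](@wmean_cst R _ _ a (sum_prod_invn R n0)).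
by apply: eq_wmean => c; case: aggr => //; rewrite wmean_cst ?sum_prod_ffun.
Qed.

Lemma le_fed_step (R : realType) (N m : nat) (X : Type) (n : 'I_N -> nat)
    (D : forall k : 'I_N, 'I_(n k) -> X) (sgrad : 'rV[R]_m -> X -> 'rV[R]_m)
    (p : 'I_N -> R) (K : nat) (eta : R) (aggr : bool)
    (f g : ('I_N -> 'rV[R]_m) -> R) (W : 'I_N -> 'rV[R]_m) :
  (forall k, 0 <= p k) -> (forall V, f V <= g V) ->
  fed_step D sgrad p K eta aggr f W <= fed_step D sgrad p K eta aggr g W.
Proof.
move=> p0 fg; rewrite !fed_stepE; apply: le_wmean => [c|c].
  by apply: prodr_ge0 => k _; rewrite invr_ge0.
by case: aggr => //; apply: le_wmean => // S; apply: prodr_ge0.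
Qed.

(** Bias and variance split: the mean of the step uses the full gradients, and the noises of
    distinct devices are independent, which is why the weights appear squared. *)
Lemma fed_step_local_dist (R : realType) (N m : nat) (X : Type) (n : 'I_N -> nat)
    (D : forall k : 'I_N, 'I_(n k) -> X) (sgrad : 'rV[R]_m -> X -> 'rV[R]_m)
    (p : 'I_N -> R) (K : nat) (eta : R) (W : 'I_N -> 'rV[R]_m) (z : 'rV[R]_m) :
  (forall k, 0 < n k)%N ->
  fed_step D sgrad p K eta false (fun V => sqn (glob_model p V - z)) W =
  sqn (glob_model p W - eta *: glob_model p (fun k => loc_grad D sgrad k (W k)) - z)
  + eta ^+ 2 * \sum_(k < N) p k ^+ 2 * ((n k)%:R^-1 *
      \sum_(j < n k) sqn (sgrad (W k) (D k j) - loc_grad D sgrad k (W k))).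
Proof.
move=> n0; rewrite fed_stepE.
set u := _ - eta *: _ - z.
pose y k (j : 'I_(n k)) : 'rV[R]_m :=
  (- (eta * p k)) *: (sgrad (W k) (D k j) - loc_grad D sgrad k (W k)).
have Vy c : sqn (glob_model p (local_steps D sgrad eta W c) - z) =
    sqn (u + \sum_k y k (c k)).
  congr sqn; rewrite /u glob_modelB.
  have -> : \sum_k y k (c k) = eta *: glob_model p (fun k => loc_grad D sgrad k (W k))
      - eta *: glob_model p (fun k => sgrad (W k) (D k (c k))).
    rewrite /glob_model !scaler_sumr -sumrB; apply: eq_bigr => k _.
    by rewrite /y scalerBr !scaleNr opprK !scalerA addrC.
  by rewrite [LHS]addrAC [X in _ = X + _]addrAC addrA addrNK.
rewrite (eq_wmean _ Vy).
(* The noise is centred because [loc_grad] is the uniform average of the sample gradients. *)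
have mean0 k : \sum_(j < n k) (n k)%:R^-1 *: y k j = 0.
  rewrite /y; under eq_bigr => j _ do rewrite scalerA mulrC -scalerA scalerBr.
  rewrite -scaler_sumr sumrB -scaler_sumr -/(loc_grad D sgrad k (W k)).
  by rewrite -scaler_suml sum_invn // scale1r subrr scaler0.
rewrite (product_law_variance (y := y) u
  (@product_law_dffun R _ _ (fun k (j : 'I_(n k)) => (n k)%:R^-1))) //; last 2 first.
- exact: sum_prod_invn.
- by move=> k; apply: sum_invn.
congr (_ + _); rewrite mulr_sumr; apply: eq_bigr => k _.
rewrite /wmean -mulr_sumr /y; under eq_bigr => j _ do rewrite sqnZ sqrrN.
by rewrite -mulr_sumr; ring.
Qed.

(** [dispersion_step] holds for every draw; the mean of the squared gradient of device [k] then
    involves only the draw of that device. *)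
Lemma fed_step_local_dispersion (R : realType) (N m : nat) (X : Type) (n : 'I_N -> nat)
    (D : forall k : 'I_N, 'I_(n k) -> X) (sgrad : 'rV[R]_m -> X -> 'rV[R]_m)
    (p : 'I_N -> R) (K : nat) (eta a : R) (W : 'I_N -> 'rV[R]_m) :
  (forall k, 0 < n k)%N -> (forall k, 0 <= p k) -> \sum_(k < N) p k = 1 -> 0 < a ->
  fed_step D sgrad p K eta false (dispersion p) W <=
  (1 + a^-1) * dispersion p W + (1 + a) * (eta ^+ 2 * \sum_(k < N) p k *
      ((n k)%:R^-1 * \sum_(j < n k) sqn (sgrad (W k) (D k j)))).
Proof.
move=> n0 p0 p1 a0; rewrite fed_stepE.
apply: (@le_trans _ _ (wmean (fun=> \prod_(k < N) (n k)%:R^-1)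
    (fun c : {dffun forall k : 'I_N, 'I_(n k)} => (1 + a^-1) * dispersion p W
      + (1 + a) * (eta ^+ 2 * \sum_(k < N) p k * sqn (sgrad (W k) (D k (c k))))))).
  apply: le_wmean => c; last exact: dispersion_step.
  by apply: prodr_ge0 => k _; rewrite invr_ge0.
rewrite wmeanD wmean_cst ?sum_prod_invn // !wmeanZ wmean_sum.
suff -> : \sum_k wmean (fun=> \prod_(k0 < N) (n k0)%:R^-1)
            (fun c : {dffun forall k : 'I_N, 'I_(n k)} => p k * sqn (sgrad (W k) (D k (c k))))
  = \sum_(k < N) p k * ((n k)%:R^-1 * \sum_(j < n k) sqn (sgrad (W k) (D k j))) by [].
apply: eq_bigr => k _; rewrite wmeanZ; congr (_ * _).
rewrite (product_law_mean1 k (fun k j => sqn (sgrad (W k) (D k j)))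
  (@product_law_dffun R _ _ (fun k (j : 'I_(n k)) => (n k)%:R^-1))); last first.
  by move=> l; apply: sum_invn.
by rewrite /wmean mulr_sumr.
Qed.

(** For fixed local steps, the server averages [K] independent draws with mean [g] and total
    variance [dispersion p V], so the average stays unbiased and has variance [K%:R^-1] times
    that. *)
Lemma fed_step_aggr_dist (R : realType) (N m : nat) (X : Type) (n : 'I_N -> nat)
    (D : forall k : 'I_N, 'I_(n k) -> X) (sgrad : 'rV[R]_m -> X -> 'rV[R]_m)
    (p : 'I_N -> R) (K : nat) (eta : R) (W : 'I_N -> 'rV[R]_m) (z : 'rV[R]_m) :
  (0 < K)%N -> \sum_(k < N) p k = 1 ->
  fed_step D sgrad p K eta true (fun V => sqn (glob_model p V - z)) W =
  fed_step D sgrad p K eta false (fun V => sqn (glob_model p V - z)) W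
  + K%:R^-1 * fed_step D sgrad p K eta false (dispersion p) W.
Proof.
move=> K0 p1; rewrite !fed_stepE -wmeanZ -wmeanD; apply: eq_wmean => c.
move: (local_steps D sgrad eta W c) => V; set g := glob_model p V.
have Kn0 : K%:R != 0 :> R by rewrite pnatr_eq0 -lt0n.
pose y (j : 'I_K) (k : 'I_N) : 'rV[R]_m := K%:R^-1 *: (V k - g).
have E (S : {ffun 'I_K -> 'I_N}) :
    sqn (glob_model p (fun=> K%:R^-1 *: \sum_(j < K) V (S j)) - z) =
    sqn ((g - z) + \sum_j y j (S j)).
  congr sqn; rewrite glob_model_cst // /y -scaler_sumr sumrB sumr_const card_ord.
  rewrite scalerBr -(scaler_nat _ g) scalerA mulVf // scale1r.
  by rewrite [RHS]addrC addrA addrNK.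
rewrite (eq_wmean _ E).
rewrite (product_law_variance (y := y) (g - z) (@product_law_ffun R 'I_K _ p)) //.
- congr (_ + _); rewrite /y sumr_const card_ord /wmean.
  under eq_bigr => k _ do rewrite sqnZ mulrCA.
  by rewrite -mulr_sumr -/(dispersion p V) -[LHS]mulr_natl; field.
- exact: sum_prod_ffun.
- move=> j; rewrite /y; under eq_bigr => k _ do rewrite scalerA mulrC -scalerA.
  by rewrite -scaler_sumr glob_modelBcst // subrr scaler0.
Qed.

Lemma fed_step_aggr_dispersion (R : realType) (N m : nat) (X : Type) (n : 'I_N -> nat)
    (D : forall k : 'I_N, 'I_(n k) -> X) (sgrad : 'rV[R]_m -> X -> 'rV[R]_m)
    (p : 'I_N -> R) (K : nat) (eta : R) (W : 'I_N -> 'rV[R]_m) :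
  \sum_(k < N) p k = 1 ->
  fed_step D sgrad p K eta true (dispersion p) W = 0.
Proof.
move=> p1; rewrite fed_stepE; apply: big1 => c _.
rewrite /wmean [X in _ * X]big1 ?mulr0 // => S _.
by rewrite dispersion_cst // mulr0.
Qed.

(** * Expectations over several steps *)

Lemma fed_expectD (R : realType) (N m : nat) (X : Type) (n : 'I_N -> nat)
    (D : forall k : 'I_N, 'I_(n k) -> X) (sgrad : 'rV[R]_m -> X -> 'rV[R]_m)
    (p : 'I_N -> R) (K E : nat) (eta : nat -> R) (s r : nat)
    (f g : ('I_N -> 'rV[R]_m) -> R) (W : 'I_N -> 'rV[R]_m) :
  fed_expect D sgrad p K E eta s r (fun V => f V + g V) W =
  fed_expect D sgrad p K E eta s r f W + fed_expect D sgrad p K E eta s r g W.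
Proof.
elim: r s W => //= r IH s W; rewrite -fed_stepD.
by congr fed_step; apply/funext => V; exact: IH.
Qed.

Lemma fed_expectZ (R : realType) (N m : nat) (X : Type) (n : 'I_N -> nat)
    (D : forall k : 'I_N, 'I_(n k) -> X) (sgrad : 'rV[R]_m -> X -> 'rV[R]_m)
    (p : 'I_N -> R) (K E : nat) (eta : nat -> R) (s r : nat) (a : R)
    (f : ('I_N -> 'rV[R]_m) -> R) (W : 'I_N -> 'rV[R]_m) :
  fed_expect D sgrad p K E eta s r (fun V => a * f V) W =
  a * fed_expect D sgrad p K E eta s r f W.
Proof.
elim: r s W => //= r IH s W; rewrite -fed_stepZ.
by congr fed_step; apply/funext => V; exact: IH.
Qed.

Lemma fed_expect_cst (R : realType) (N m : nat) (X : Type) (n : 'I_N -> nat)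
    (D : forall k : 'I_N, 'I_(n k) -> X) (sgrad : 'rV[R]_m -> X -> 'rV[R]_m)
    (p : 'I_N -> R) (K E : nat) (eta : nat -> R) (s r : nat) (a : R)
    (W : 'I_N -> 'rV[R]_m) :
  (forall k, 0 < n k)%N -> \sum_(k < N) p k = 1 ->
  fed_expect D sgrad p K E eta s r (fun=> a) W = a.
Proof.
move=> n0 p1; elim: r s W => //= r IH s W.
rewrite -[RHS](fed_step_cst D sgrad K (eta s) (E %| s.+1)%N a W n0 p1).
by congr fed_step; apply/funext => V; exact: IH.
Qed.

Lemma le_fed_expect (R : realType) (N m : nat) (X : Type) (n : 'I_N -> nat)
    (D : forall k : 'I_N, 'I_(n k) -> X) (sgrad : 'rV[R]_m -> X -> 'rV[R]_m)
    (p : 'I_N -> R) (K E : nat) (eta : nat -> R) (s r : nat)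
    (f g : ('I_N -> 'rV[R]_m) -> R) (W : 'I_N -> 'rV[R]_m) :
  (forall k, 0 <= p k) -> (forall V, f V <= g V) ->
  fed_expect D sgrad p K E eta s r f W <= fed_expect D sgrad p K E eta s r g W.
Proof.
move=> p0 fg; elim: r s W => //= r IH s W.
by apply: le_fed_step => // V; exact: IH.
Qed.

(** The definition peels off the first step, whereas induction on time needs the last one
    isolated. *)
Lemma fed_expectSr (R : realType) (N m : nat) (X : Type) (n : 'I_N -> nat)
    (D : forall k : 'I_N, 'I_(n k) -> X) (sgrad : 'rV[R]_m -> X -> 'rV[R]_m)
    (p : 'I_N -> R) (K E : nat) (eta : nat -> R) (s r : nat)
    (f : ('I_N -> 'rV[R]_m) -> R) (W : 'I_N -> 'rV[R]_m) :
  fed_expect D sgrad p K E eta s r.+1 f W =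
  fed_expect D sgrad p K E eta s r
    (fed_step D sgrad p K (eta (s + r)%N) (E %| (s + r).+1)%N f) W.
Proof.
elim: r s W => [|r IH] s W; first by rewrite /= addn0.
rewrite [RHS]/= -addSnnS.
transitivity (fed_step D sgrad p K (eta s) (E %| s.+1)%N
  (fed_expect D sgrad p K E eta s.+1 r.+1 f) W); first by [].
by congr fed_step; apply/funext => V; exact: IH.
Qed.

(** The bound [1 <= t] matters: the horizon [t.-1] is truncated, so times 0 and 1 denote the same
    initial state. *)
Lemma fedavg_ES (R : realType) (N m : nat) (X : Type) (n : 'I_N -> nat)
    (D : forall k : 'I_N, 'I_(n k) -> X) (sgrad : 'rV[R]_m -> X -> 'rV[R]_m)
    (p : 'I_N -> R) (K E : nat) (eta : nat -> R) (w1 : 'rV[R]_m) (t : nat)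
    (f : ('I_N -> 'rV[R]_m) -> R) :
  (1 <= t)%N ->
  fedavg_E D sgrad p K E eta w1 t.+1 f =
  fedavg_E D sgrad p K E eta w1 t (fed_step D sgrad p K (eta t) (E %| t.+1)%N f).
Proof. by case: t => // t _; rewrite /fedavg_E /= -fed_expectSr. Qed.

Lemma fedavg_E_sum (R : realType) (N m : nat) (X : Type) (n : 'I_N -> nat)
    (D : forall k : 'I_N, 'I_(n k) -> X) (sgrad : 'rV[R]_m -> X -> 'rV[R]_m)
    (p : 'I_N -> R) (K E : nat) (eta : nat -> R) (w1 : 'rV[R]_m) (t : nat)
    (a : 'I_N -> R) (f : 'I_N -> ('I_N -> 'rV[R]_m) -> R) :
  (forall k, 0 < n k)%N -> \sum_(k < N) p k = 1 ->
  fedavg_E D sgrad p K E eta w1 t (fun W => \sum_(k < N) a k * f k W) =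
  \sum_(k < N) a k * fedavg_E D sgrad p K E eta w1 t (f k).
Proof.
move=> n0 p1; rewrite /fedavg_E; elim: (index_enum _) => [|k l IH].
  rewrite big_nil -[RHS](fed_expect_cst D sgrad K E eta 1 t.-1 0 (fun=> w1) n0 p1).
  by congr fed_expect; apply/funext => W; rewrite big_nil.
rewrite big_cons -IH -fed_expectZ -fed_expectD.
by congr fed_expect; apply/funext => W; rewrite big_cons.
Qed.

(** * Growth of the dispersion between aggregations *)

Lemma fedavg_local_dispersion (R : realType) (N m : nat) (X : Type) (n : 'I_N -> nat)
    (D : forall k : 'I_N, 'I_(n k) -> X) (sgrad : 'rV[R]_m -> X -> 'rV[R]_m)
    (p : 'I_N -> R) (K E : nat) (eta : nat -> R) (w1 : 'rV[R]_m) (G h : R) (t j : nat) :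
  (forall k, 0 < n k)%N -> (forall k, 0 <= p k) -> \sum_(k < N) p k = 1 ->
  0 <= eta t <= h ->
  (forall k, fedavg_E D sgrad p K E eta w1 t
       (fun W => (n k)%:R^-1 * \sum_(j < n k) sqn (sgrad (W k) (D k j))) <= G ^+ 2) ->
  fedavg_E D sgrad p K E eta w1 t (dispersion p) <= (j%:R * h) ^+ 2 * G ^+ 2 ->
  fedavg_E D sgrad p K E eta w1 t
    (fed_step D sgrad p K (eta t) false (dispersion p)) <=
  (j.+1%:R * h) ^+ 2 * G ^+ 2.
Proof.
move=> n0 p0 p1 /andP[e0 eh] A4 disp.
set lhs := fedavg_E _ _ _ _ _ _ _ _ (fed_step _ _ _ _ _ _ _).
(* The Young parameter stays free, since its best value [j] is not admissible when [j = 0]. *)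
have bound a : 0 < a ->
    lhs <= (1 + a^-1) * ((j%:R * h) ^+ 2 * G ^+ 2) + (1 + a) * (h ^+ 2 * G ^+ 2).
  move=> a0; apply: le_trans (le_fed_expect _ _ _ _ _ _ _ _ p0
    (fun W => fed_step_local_dispersion D sgrad K (eta t) W n0 p0 p1 a0)) _.
  rewrite fed_expectD !fed_expectZ; apply: lerD.
    by apply: ler_wpM2l => //; rewrite addr_ge0 ?invr_ge0 ?ltW.
  apply: ler_wpM2l; first by rewrite addr_ge0 ?ltW.
  apply: (@le_trans _ _ (eta t ^+ 2 * G ^+ 2)).
    apply: ler_wpM2l; first exact: sqr_ge0.
    rewrite -/(fedavg_E D sgrad p K E eta w1 t _) fedavg_E_sum //.
    rewrite -[leRHS]mul1r -[X in _ <= X * _]p1 mulr_suml; apply: ler_sum => k _.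
    exact: ler_wpM2l.
  by apply: ler_wpM2r; rewrite ?sqr_ge0 // lerXn2r ?nnegrE ?(le_trans e0).
case: j disp bound => [|j] _ bound.
  (* For [j = 0] the previous dispersion contributes nothing and the parameter is sent to 0. The
     choice [e / (c + 1)] makes the excess at most [e], the [+ 1] covering [c = 0]. *)
  rewrite mul1r; apply/ler_addgt0Pr => e egt0.
  have c0 : 0 <= h ^+ 2 * G ^+ 2 by rewrite mulr_ge0 ?sqr_ge0.
  move: bound; set c := h ^+ 2 * G ^+ 2 in c0 * => bound.
  have a0 : 0 < e / (c + 1) by rewrite divr_gt0 ?ltr_wpDl.
  apply: le_trans (bound _ a0) _.
  rewrite mul0r expr0n mul0r mulr0 add0r mulrDl mul1r lerD2l.
  rewrite mulrAC ler_pdivrMr ?ltr_wpDl //; nra.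
have j0 : (0 : R) < j.+1%:R by rewrite ltr0n.
apply: le_trans (bound _ j0) _.
rewrite le_eqVlt; apply/orP; left; apply/eqP.
by rewrite -[j.+2%:R]natr1; field; rewrite gt_eqF.
Qed.

(* [t0] is the last synchronisation time before [t], at which all local models
   agree; it is [1] before the first aggregation. *)
Lemma fedavg_dispersion (R : realType) (N m : nat) (X : Type) (n : 'I_N -> nat)
    (D : forall k : 'I_N, 'I_(n k) -> X) (sgrad : 'rV[R]_m -> X -> 'rV[R]_m)
    (p : 'I_N -> R) (K E : nat) (eta : nat -> R) (w1 : 'rV[R]_m) (G : R) (t : nat) :
  (forall k, 0 < n k)%N -> (forall k, 0 <= p k) -> \sum_(k < N) p k = 1 ->
  (0 < E)%N -> (forall t, (1 <= t)%N -> 0 <= eta t) ->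
  (forall s t, (1 <= s <= t)%N -> eta t <= eta s) ->
  (forall k t, (1 <= t)%N -> fedavg_E D sgrad p K E eta w1 t
       (fun W => (n k)%:R^-1 * \sum_(j < n k) sqn (sgrad (W k) (D k j))) <= G ^+ 2) ->
  (1 <= t)%N ->
  exists t0, [/\ (1 <= t0 <= t)%N, (t - t0 <= t %% E)%N &
    fedavg_E D sgrad p K E eta w1 t (dispersion p) <=
      ((t - t0)%:R * eta t0) ^+ 2 * G ^+ 2].
Proof.
move=> n0 p0 p1 E0 eta0 eta_mono A4; case: t => // t _.
elim: t => [|t [t0 [/andP[t01 t0t] tE IH]]].
  (* All devices start from [w1], so time 1 counts as a synchronisation. *)
  exists 1%N; split=> //.
  by rewrite /fedavg_E /= dispersion_cst // subnn mul0r expr0n mul0r.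
have [dvdE|ndvdE] := boolP (E %| t.+2)%N.
  exists t.+2; rewrite subnn leqnn; split=> //.
  rewrite fedavg_ES // dvdE mul0r expr0n mul0r.
  rewrite -[leRHS](fed_expect_cst D sgrad K E eta 1 t 0 (fun=> w1) n0 p1).
  by apply: le_fed_expect => // V; rewrite fed_step_aggr_dispersion.
exists t0; split; first by rewrite t01 leqW.
  rewrite subSn //.
  (* Away from multiples of [E] the residue increases by one without wrapping, in step with the
     number of local steps. *)
  have : (t.+2 %% E = (t.+1 %% E).+1)%N.
    have lt : ((t.+1 %% E).+1 < E)%N.
      rewrite ltn_neqAle ltn_pmod // andbT; apply: contraNneq ndvdE => e.
      by rewrite /dvdn -[t.+2]addn1 -modnDml addn1 e modnn.
    by rewrite -[t.+2]addn1 -modnDml addn1 modn_small.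
  by move=> ->.
rewrite fedavg_ES // (negbTE ndvdE) subSn //.
apply: fedavg_local_dispersion => //; last by move=> k; exact: A4.
by rewrite eta0 // eta_mono // t01.
Qed.

(** * Step-size recursion and convergence of the mean model *)

(** With [s = gamma + t], the step turns a bound [v / s] into at most [(1 - 2 / s) * (v / s) + v / s
    ^+ 2 = v * (s - 1) / s ^+ 2], which is below [v / (s + 1)] because
    [(s - 1) * (s + 1) <= s ^+ 2]. The two summands of [v] cover the noise and the initial
    distance. *)
Lemma stepsize_recursion (R : realType) (mu gamma B d0 : R) (d : nat -> R) :
  0 < mu -> 1 <= gamma -> 0 <= B -> 0 <= d0 -> d 1%N <= d0 ->
  (forall t, (1 <= t)%N ->
     d t.+1 <= (1 - 2 / (mu * (gamma + t%:R)) * mu) * d t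
               + (2 / (mu * (gamma + t%:R))) ^+ 2 * B) ->
  forall t, (1 <= t)%N ->
  d t <= (4 * B / mu ^+ 2 + (gamma + 1) * d0) / (gamma + t%:R).
Proof.
move=> mu0 g1 B0 d00 d1 rec; case=> // t _.
set b := 4 * B / mu ^+ 2; set v := b + _.
have b0 : 0 <= b by rewrite divr_ge0 ?sqr_ge0 ?mulr_ge0.
have bv : b <= v by rewrite lerDl mulr_ge0 ?addr_ge0 // (le_trans ler01).
have v0 : 0 <= v by exact: le_trans bv.
elim: t => [|t IH].
  have g0 : 0 < gamma + 1 by rewrite ltr_wpDl // (le_trans ler01).
  rewrite ler_pdivlMr // /v; nra.
apply: le_trans (rec t.+1 isT) _.
move: IH; rewrite -[t.+2%:R]natr1 addrA; set s := gamma + t.+1%:R.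
(* Keeps the contraction factor nonnegative, so that the induction hypothesis may be multiplied by
   it. *)
have s2 : 2 <= s.
  have : (1 : R) <= t.+1%:R by rewrite ler1n.
  by rewrite /s; lra.
have s0 : 0 < s by lra.
have -> : 2 / (mu * s) * mu = 2 / s by field; rewrite !gt_eqF.
have -> : (2 / (mu * s)) ^+ 2 * B = b / s ^+ 2 by rewrite /b; field; rewrite !gt_eqF.
have c0 : 0 <= 1 - 2 / s by rewrite subr_ge0 ler_pdivrMr // mul1r.
move=> /(ler_wpM2l c0) IH.
apply: (@le_trans _ _ ((1 - 2 / s) * (v / s) + v / s ^+ 2)).
  by apply: lerD => //; rewrite ler_wpM2r // invr_ge0 sqr_ge0.
rewrite -subr_ge0.
have -> : v / (s + 1) - ((1 - 2 / s) * (v / s) + v / s ^+ 2) = v / (s ^+ 2 * (s + 1)).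
  by field; rewrite !gt_eqF // ltr_wpDr.
by rewrite divr_ge0 // mulr_ge0 ?sqr_ge0 // addr_ge0 // ltW.
Qed.

(** Both quadratic bounds are compared at one nonzero vector. This makes [L] positive in positive
    dimension. *)
Lemma strongly_convex_le_smooth (R : realType) (m : nat) (L mu : R)
    (f : 'rV[R]_m -> R) (gf : 'rV[R]_m -> 'rV[R]_m) :
  (0 < m)%N -> smooth L f gf -> strongly_convex mu f gf -> mu <= L.
Proof.
move=> m0 sm sc; have [u u0] := sqn_gt0_ex R m0.
have := le_trans (sc u 0) (sm u 0); rewrite subr0 lerD2l ler_pM2r //; lra.
Qed.

Lemma heterogeneity_ge0 (R : realType) (N m : nat) (X : Type)
    (n : 'I_N -> nat) (D : forall k : 'I_N, 'I_(n k) -> X)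
    (loss : 'rV[R]_m -> X -> R) (p : 'I_N -> R) (w : 'rV[R]_m) (wk : 'I_N -> 'rV[R]_m) :
  (forall k, 0 <= p k) ->
  (forall k w, loc_obj D loss k (wk k) <= loc_obj D loss k w) ->
  0 <= glob_obj D loss p w - \sum_(k < N) p k * loc_obj D loss k (wk k).
Proof.
by move=> p0 wkmin; rewrite subr_ge0; apply: ler_sum => k _; rewrite ler_wpM2l.
Qed.

(** The expected squared distance satisfies the hypothesis of [stepsize_recursion] with noise
    constant [B + C]: [B] collects the local step, [C] the sampling variance of an aggregation. *)
Lemma fedavg_convergence_pos (R : realType) (N m : nat) (X : Type)
    (n : 'I_N -> nat) (D : forall k : 'I_N, 'I_(n k) -> X)
    (loss : 'rV[R]_m -> X -> R) (sgrad : 'rV[R]_m -> X -> 'rV[R]_m)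
    (p : 'I_N -> R) (E K : nat) (w1 : 'rV[R]_m)
    (L mu G gamma : R) (sigma : 'I_N -> R)
    (wstar : 'rV[R]_m) (wkstar : 'I_N -> 'rV[R]_m)
    (eta := fun t : nat => 2 / (mu * (gamma + t%:R)))
    (Gamma := glob_obj D loss p wstar - \sum_(k < N) p k * loc_obj D loss k (wkstar k))
    (B := \sum_(k < N) p k ^+ 2 * sigma k ^+ 2 + 6 * L * Gamma
           + 8 * (E%:R - 1) ^+ 2 * G ^+ 2)
    (C := 4 / K%:R * E%:R ^+ 2 * G ^+ 2) :
  (forall k, 0 < n k)%N ->
  (forall k, 0 <= p k) -> \sum_(k < N) p k = 1 ->
  (1 <= E)%N -> (1 <= K)%N ->
  (forall k, smooth L (loc_obj D loss k) (loc_grad D sgrad k)) ->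
  0 < mu -> 0 < L ->
  (forall k, strongly_convex mu (loc_obj D loss k) (loc_grad D sgrad k)) ->
  (forall w, glob_obj D loss p wstar <= glob_obj D loss p w) ->
  (forall k w, loc_obj D loss k (wkstar k) <= loc_obj D loss k w) ->
  8 * L / mu <= gamma -> E%:R <= gamma ->
  (forall k t, (1 <= t)%N ->
     fedavg_E D sgrad p K E eta w1 t
       (fun W => (n k)%:R^-1 *
          \sum_(j < n k) sqn (sgrad (W k) (D k j) - loc_grad D sgrad k (W k)))
     <= sigma k ^+ 2) ->
  (forall k t, (1 <= t)%N ->
     fedavg_E D sgrad p K E eta w1 t
       (fun W => (n k)%:R^-1 * \sum_(j < n k) sqn (sgrad (W k) (D k j)))
     <= G ^+ 2) ->
  forall t : nat, (1 <= t)%N ->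
  fedavg_E D sgrad p K E eta w1 t (fun W => sqn (glob_model p W - wstar)) <=
  (4 * (B + C) / mu ^+ 2 + (gamma + 1) * sqn (w1 - wstar)) / (gamma + t%:R).
Proof.
move=> n0 p0 p1 E1 K1 sm mu0 L0 sc wmin wkmin gL gE A3 A4.
have Gam0 : 0 <= Gamma by exact: heterogeneity_ge0.
have E1R : (1 : R) <= E%:R by rewrite ler1n.
have g1 : 1 <= gamma by exact: le_trans gE.
have C0 : 0 <= C 
  by apply: mulr_ge0 (sqr_ge0 _); apply: mulr_ge0 (sqr_ge0 _); rewrite divr_ge0.
have B0 : 0 <= B.
  apply: addr_ge0; last by apply: mulr_ge0 (sqr_ge0 _); apply: mulr_ge0 (sqr_ge0 _).
  apply: addr_ge0; last by apply: mulr_ge0 => //; apply: mulr_ge0 => //; exact: ltW.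
  by apply: sumr_ge0 => k _; apply: mulr_ge0; exact: sqr_ge0.
have s0 t : 0 < gamma + t%:R by rewrite ltr_wpDr // (lt_le_trans ltr01).
have ms0 t : 0 < mu * (gamma + t%:R) by rewrite mulr_gt0.
have eta0 t : 0 < eta t by rewrite /eta divr_gt0.
have eta_mono s t : (1 <= s <= t)%N -> eta t <= eta s.
  case/andP=> _ st; rewrite /eta ler_pM2l // lef_pV2 ?posrE // ler_pM2l //.
  by rewrite lerD2l ler_nat.
(* From [8 * L / mu <= gamma]: the step size is at most [2 / (mu * gamma)]. *)
have etaL t : eta t * L <= 1 / 4.
  rewrite /eta mulrAC ler_pdivrMr //; move: gL; rewrite ler_pdivrMr // => gL.
  have : 0 <= mu * t%:R by rewrite mulr_ge0 // ltW.
  lra.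
(* From [E%:R <= gamma]: over [E] rounds the denominator at most doubles. Squaring this factor 2
   produces the 4 in [C], and the 8 in [B] together with the factor 2 on the dispersion. *)
have eta2 t0 t : (t <= t0 + E)%N -> eta t0 <= 2 * eta t.
  move=> tt0; have tt0R : t%:R <= t0%:R + E%:R :> R by rewrite -natrD ler_nat.
  rewrite /eta ler_pM2l // ler_pdivlMr // mulrC ler_pdivrMr // mulrCA ler_pM2l //.
  by have := ler0n R t0; lra.
apply: stepsize_recursion => //; first by rewrite addr_ge0.
- exact: sqn_ge0.
- by rewrite /fedavg_E /= glob_model_cst.
move=> t t1; rewrite -/(eta t) fedavg_ES //.
have [t0 [/andP[t01 t0t] tE disp]] :=
  fedavg_dispersion n0 p0 p1 E1 (fun s _ => ltW (eta0 s)) eta_mono A4 t1.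
have tE1 : (t - t0 < E)%N by apply: leq_ltn_trans tE _; rewrite ltn_pmod.
have h0 : 0 <= eta t0 by exact: ltW.
have h2 : eta t0 <= 2 * eta t.
  by apply: eta2; rewrite -leq_subLR ltnW.
have sq_bound (a b : R) : 0 <= a -> a <= b ->
    (a * eta t0) ^+ 2 * G ^+ 2 <= 4 * eta t ^+ 2 * (b ^+ 2 * G ^+ 2).
  move=> a0 ab.
  have -> : 4 * eta t ^+ 2 * (b ^+ 2 * G ^+ 2) = (b * (2 * eta t)) ^+ 2 * G ^+ 2 by ring.
  have le1 : a * eta t0 <= b * (2 * eta t) by exact: ler_pM.
  have ge1 : 0 <= a * eta t0 by exact: mulr_ge0.
  apply: ler_wpM2r; first exact: sqr_ge0.
  by rewrite lerXn2r ?nnegrE // (le_trans ge1).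
(* At most [E - 1] local steps separate [t] from the last synchronisation. *)
have dispE : fedavg_E D sgrad p K E eta w1 t (dispersion p) <=
    4 * eta t ^+ 2 * ((E%:R - 1) ^+ 2 * G ^+ 2).
  apply: le_trans disp (sq_bound _ _ _ _) => //.
  by rewrite lerBrDr natr1 ler_nat.
(* The models that the server averages have made one more local step, hence [E] in place of
   [E - 1]. *)
have dispV : fedavg_E D sgrad p K E eta w1 t
      (fed_step D sgrad p K (eta t) false (dispersion p)) <=
    4 * eta t ^+ 2 * (E%:R ^+ 2 * G ^+ 2).
  apply: le_trans (fedavg_local_dispersion n0 p0 p1 _ _ disp) (sq_bound _ _ _ _) => //.
  - by rewrite (ltW (eta0 t)) eta_mono // t01.
  - by move=> k; exact: A4.
  - by rewrite ler_nat.
have distE : fedavg_E D sgrad p K E eta w1 t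
      (fed_step D sgrad p K (eta t) false (fun V => sqn (glob_model p V - wstar))) <=
    (1 - eta t * mu) * fedavg_E D sgrad p K E eta w1 t (fun V => sqn (glob_model p V - wstar))
    + eta t ^+ 2 * B.
  pose noise k (W : 'I_N -> 'rV[R]_m) := (n k)%:R^-1 *
    \sum_(j < n k) sqn (sgrad (W k) (D k j) - loc_grad D sgrad k (W k)).
  apply: (@le_trans _ _ (fedavg_E D sgrad p K E eta w1 t (fun W =>
     (1 - eta t * mu) * sqn (glob_model p W - wstar) + 2 * dispersion p W
     + 6 * eta t ^+ 2 * L * Gamma + eta t ^+ 2 * \sum_(k < N) p k ^+ 2 * noise k W))).
    apply: le_fed_expect => // W; rewrite fed_step_local_dist // lerD2r.
    exact: (@global_descent R N m p L mu (eta t) (loc_obj D loss)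
      (loc_grad D sgrad) (fun k => loc_obj D loss k (wkstar k))).
  rewrite /fedavg_E !fed_expectD !fed_expectZ fed_expect_cst //.
  rewrite -!/(fedavg_E D sgrad p K E eta w1 t _) fedavg_E_sum //.
  have noiseE : \sum_(k < N) p k ^+ 2 * fedavg_E D sgrad p K E eta w1 t (noise k) <=
      \sum_(k < N) p k ^+ 2 * sigma k ^+ 2.
    by apply: ler_sum => k _; rewrite ler_wpM2l ?sqr_ge0 //; exact: A3.
  have := ler_wpM2l (sqr_ge0 (eta t)) noiseE.
  by rewrite /B; lra.
have eC : eta t ^+ 2 * C = K%:R^-1 * (4 * eta t ^+ 2 * (E%:R ^+ 2 * G ^+ 2)).
  by rewrite /C; ring.
(* Without aggregation the term with [C] is only slack; with it, that term pays for the sampling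
   variance. *)
rewrite mulrDr addrA; case: (E %| t.+1)%N; last first.
  by apply: le_trans distE _; rewrite lerDl mulr_ge0 ?sqr_ge0.
apply: (@le_trans _ _ (fedavg_E D sgrad p K E eta w1 t (fun W =>
   fed_step D sgrad p K (eta t) false (fun V => sqn (glob_model p V - wstar)) W
   + K%:R^-1 * fed_step D sgrad p K (eta t) false (dispersion p) W))).
  by apply: le_fed_expect => // W; rewrite fed_step_aggr_dist.
rewrite /fedavg_E fed_expectD fed_expectZ eC; apply: lerD => //.
by apply: ler_wpM2l; rewrite ?invr_ge0.
Qed.

(* For [m = 0] the constant [L] may be negative, but then all iterates coincide
   with [wstar] and [Gamma = 0]. *)
Lemma fedavg_convergence (R : realType) (N m : nat) (X : Type)
    (n : 'I_N -> nat) (D : forall k : 'I_N, 'I_(n k) -> X)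
    (loss : 'rV[R]_m -> X -> R) (sgrad : 'rV[R]_m -> X -> 'rV[R]_m)
    (p : 'I_N -> R) (E K : nat) (w1 : 'rV[R]_m)
    (L mu G gamma : R) (sigma : 'I_N -> R)
    (wstar : 'rV[R]_m) (wkstar : 'I_N -> 'rV[R]_m)
    (eta := fun t : nat => 2 / (mu * (gamma + t%:R)))
    (Gamma := glob_obj D loss p wstar - \sum_(k < N) p k * loc_obj D loss k (wkstar k))
    (B := \sum_(k < N) p k ^+ 2 * sigma k ^+ 2 + 6 * L * Gamma
           + 8 * (E%:R - 1) ^+ 2 * G ^+ 2)
    (C := 4 / K%:R * E%:R ^+ 2 * G ^+ 2) :
  (forall k, 0 < n k)%N ->
  (forall k, 0 <= p k) -> \sum_(k < N) p k = 1 ->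
  (1 <= E)%N -> (1 <= K)%N ->
  (forall k, smooth L (loc_obj D loss k) (loc_grad D sgrad k)) ->
  0 < mu ->
  (forall k, strongly_convex mu (loc_obj D loss k) (loc_grad D sgrad k)) ->
  (forall w, glob_obj D loss p wstar <= glob_obj D loss p w) ->
  (forall k w, loc_obj D loss k (wkstar k) <= loc_obj D loss k w) ->
  8 * L / mu <= gamma -> E%:R <= gamma ->
  (forall k t, (1 <= t)%N ->
     fedavg_E D sgrad p K E eta w1 t
       (fun W => (n k)%:R^-1 *
          \sum_(j < n k) sqn (sgrad (W k) (D k j) - loc_grad D sgrad k (W k)))
     <= sigma k ^+ 2) ->
  (forall k t, (1 <= t)%N ->
     fedavg_E D sgrad p K E eta w1 t
       (fun W => (n k)%:R^-1 * \sum_(j < n k) sqn (sgrad (W k) (D k j)))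
     <= G ^+ 2) ->
  forall t : nat, (1 <= t)%N ->
  fedavg_E D sgrad p K E eta w1 t (fun W => sqn (glob_model p W - wstar)) <=
  (4 * (B + C) / mu ^+ 2 + (gamma + 1) * sqn (w1 - wstar)) / (gamma + t%:R).
Proof.
have [m0|m0] := posnP m; last first.
  move=> n0 p0 p1 E1 K1 sm mu0 sc wmin wkmin gL gE A3 A4 t t1.
  have L0 : 0 < L.
    (* Since the weights sum to 1 there is at least one device, to which the comparison of [mu] and
       [L] applies. *)
    case: N n D p sigma wkstar @eta @Gamma @B @C n0 p0 p1 sm sc wmin wkmin A3 A4 => [|N] n D p
        sigma wkstar eta Gamma B C n0 p0 p1 sm sc *.
      by move/eqP: p1; rewrite big_ord0 eq_sym oner_eq0.
    exact: lt_le_trans mu0 (strongly_convex_le_smooth m0 (sm ord0) (sc ord0)).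
  exact: fedavg_convergence_pos.
move=> n0 p0 p1 E1 K1 sm mu0 sc wmin wkmin gL gE A3 A4 t t1.
have Gamma0 : Gamma = 0.
  rewrite /Gamma /glob_obj -sumrB big1 // => k _.
  by rewrite (rV_eq_dim0 (wkstar k) wstar m0) subrr.
have -> : fedavg_E D sgrad p K E eta w1 t (fun W => sqn (glob_model p W - wstar)) = 0.
  rewrite -[RHS](fed_expect_cst D sgrad K E eta 1 t.-1 0 (fun=> w1) n0 p1).
  congr fed_expect; apply/funext => W.
  by rewrite (rV_eq_dim0 (glob_model p W - wstar) 0 m0) sqn0.
have g0 : 0 <= gamma by apply: le_trans gE.
have B0 : 0 <= B.
  rewrite /B Gamma0 mulr0 addr0; apply: addr_ge0.
    by apply: sumr_ge0 => k _; apply: mulr_ge0; exact: sqr_ge0.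
  by apply: mulr_ge0 (sqr_ge0 _); apply: mulr_ge0 (sqr_ge0 _).
have C0 : 0 <= C.
  by apply: mulr_ge0 (sqr_ge0 _); apply: mulr_ge0 (sqr_ge0 _); rewrite divr_ge0.
apply: divr_ge0; last exact: addr_ge0.
apply: addr_ge0; last by apply: mulr_ge0 (sqn_ge0 _); exact: addr_ge0.
by apply: mulr_ge0; [apply: mulr_ge0 => //; exact: addr_ge0 | rewrite invr_ge0 sqr_ge0].
Qed.

(** * From the model error to the reconstruction error *)

(** The randomness of training is finite, so the expectation is a finite combination of the
    functions [f o V]. *)
Lemma measurable_fed_expect (R : realType) (N m : nat) (X : Type) (n : 'I_N -> nat)
    (D : forall k : 'I_N, 'I_(n k) -> X) (sgrad : 'rV[R]_m -> X -> 'rV[R]_m)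
    (p : 'I_N -> R) (K E : nat) (eta : nat -> R) (s r : nat)
    (dT : measure_display) (T : measurableType dT)
    (f : T -> ('I_N -> 'rV[R]_m) -> R) (W : 'I_N -> 'rV[R]_m) :
  (forall V, measurable_fun setT (fun o => f o V)) ->
  measurable_fun setT (fun o => fed_expect D sgrad p K E eta s r (f o) W).
Proof.
move=> mf; elim: r s W => //= r IH s W.
apply: measurable_sum => c; apply: measurable_funM; first exact: measurable_cst.
case: (E %| s.+1)%N; last exact: IH.
apply: measurable_sum => S; apply: measurable_funM; first exact: measurable_cst.
exact: IH.
Qed.

Lemma sqn_lipschitz (R : realType) (m d : nat) (F : 'rV[R]_m -> 'rV[R]_d) (LR : R)
    (v w : 'rV[R]_m) :
  enorm (F v - F w) <= LR * enorm (v - w) -> sqn (F v - F w) <= LR ^+ 2 * sqn (v - w).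
Proof.
move=> h; rewrite -(sqr_sqrtr (sqn_ge0 (F v - F w))) -(sqr_sqrtr (sqn_ge0 (v - w))).
rewrite -exprMn lerXn2r ?nnegrE ?sqrtr_ge0 //.
(* The right-hand side is nonnegative because it dominates a norm; this permits squaring. *)
by apply: le_trans h; rewrite sqrtr_ge0.
Qed.

(** Independence of reconstruction and training is expressed by the iterated form: a finite
    expectation over training inside an integral over the randomness of [Rec]. The integrals take
    extended real values, so the inequality makes sense even when they are infinite. *)
Theorem theorem2 (R : realType) (N m d : nat) (X : Type)
    (n : 'I_N -> nat) (D : forall k : 'I_N, 'I_(n k) -> X)
    (loss : 'rV[R]_m -> X -> R) (sgrad : 'rV[R]_m -> X -> 'rV[R]_m)
    (p : 'I_N -> R) (E K : nat) (w1 : 'rV[R]_m)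
    (L mu G : R) (sigma : 'I_N -> R)
    (wstar : 'rV[R]_m) (wkstar : 'I_N -> 'rV[R]_m)
    (dT : measure_display) (T : measurableType dT) (P : probability T R)
    (Rec : T -> 'rV[R]_m -> 'rV[R]_d) (LR : R) (x : 'rV[R]_d) :
  (forall k, 0 < n k)%N ->
  (forall k, 0 <= p k) -> \sum_(k < N) p k = 1 ->
  (1 <= E)%N -> (1 <= K)%N -> (K <= N)%N ->
  (* sgrad w xi is the gradient of the sample loss l(. ; xi) *)
  (forall xi, is_gradient (fun w => loss w xi) (fun w => sgrad w xi)) ->
  (* (A1), (A2) *)
  (forall k, smooth L (loc_obj D loss k) (loc_grad D sgrad k)) ->
  0 < mu ->
  (forall k, strongly_convex mu (loc_obj D loss k) (loc_grad D sgrad k)) ->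
  (* w* minimizes the global objective, wkstar k minimizes L_k *)
  (forall w, glob_obj D loss p wstar <= glob_obj D loss p w) ->
  (forall k w, loc_obj D loss k (wkstar k) <= loc_obj D loss k w) ->
  let gamma := Num.max (8 * L / mu) E%:R in
  let eta := fun t : nat => 2 / (mu * (gamma + t%:R)) in
  (* (A3) *)
  (forall k t, (1 <= t)%N ->
     fedavg_E D sgrad p K E eta w1 t
       (fun W => (n k)%:R^-1 *
          \sum_(j < n k) sqn (sgrad (W k) (D k j) - loc_grad D sgrad k (W k)))
     <= sigma k ^+ 2) ->
  (* (A4) *)
  (forall k t, (1 <= t)%N ->
     fedavg_E D sgrad p K E eta w1 t
       (fun W => (n k)%:R^-1 * \sum_(j < n k) sqn (sgrad (W k) (D k j)))
     <= G ^+ 2) ->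
  (* randomized reconstruction: each realization L_R-Lipschitz *)
  (forall o v w, enorm (Rec o v - Rec o w) <= LR * enorm (v - w)) ->
  (forall v i, measurable_fun setT (fun o => Rec o v 0 i)) ->
  (forall i, 0 <= x 0 i <= 1) ->
  let Gamma := glob_obj D loss p wstar
               - \sum_(k < N) p k * loc_obj D loss k (wkstar k) in
  let B := \sum_(k < N) p k ^+ 2 * sigma k ^+ 2 + 6 * L * Gamma
           + 8 * (E%:R - 1) ^+ 2 * G ^+ 2 in
  let C := 4 / K%:R * E%:R ^+ 2 * G ^+ 2 in
  forall t : nat, (1 <= t)%N ->
  (\int[P]_o (fedavg_E D sgrad p K E eta w1 t
                (fun W => sqn (x - Rec o (glob_model p W))))%:E
   <= 2%:E * \int[P]_o (sqn (x - Rec o wstar))%:E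
      + (2 * LR ^+ 2 / (gamma + t%:R)
         * (4 * (B + C) / mu ^+ 2 + (gamma + 1) * sqn (w1 - wstar)))%:E)%E.
Proof.
move=> n0 p0 p1 E1 K1 _ _ sm mu0 sc wmin wkmin gamma eta A3 A4 lip mRec _ Gamma B C t t1.
set v := 4 * (B + C) / mu ^+ 2 + (gamma + 1) * sqn (w1 - wstar).
have conv : fedavg_E D sgrad p K E eta w1 t (fun W => sqn (glob_model p W - wstar))
    <= v / (gamma + t%:R).
  apply: (@fedavg_convergence R N m X n D loss sgrad p E K w1 L mu G gamma sigma
    wstar wkstar) => //; by rewrite /gamma le_max lexx ?orbT.
set b := 2 * LR ^+ 2 / (gamma + t%:R) * v.
have bE : b = 2 * LR ^+ 2 * (v / (gamma + t%:R)) by rewrite /b; ring.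
(* Nonnegativity is read off from [conv], whose left side is an expected square; it allows the
   nonnegative integral to be split below. *)
have b0 : 0 <= b.
  rewrite bE; apply: mulr_ge0; first by apply: mulr_ge0 => //; exact: sqr_ge0.
  apply: le_trans conv.
  rewrite -[leLHS](fed_expect_cst D sgrad K E eta 1 t.-1 0 (fun=> w1) n0 p1).
  by apply: le_fed_expect => // W; exact: sqn_ge0.
(* The bound holds for each realization of [Rec]; Young's inequality with parameter 1 gives both
   factors 2. *)
have pointwise o : fedavg_E D sgrad p K E eta w1 t
      (fun W => sqn (x - Rec o (glob_model p W))) <= 2 * sqn (x - Rec o wstar) + b.
  apply: (@le_trans _ _ (fedavg_E D sgrad p K E eta w1 t (fun W =>
      2 * sqn (x - Rec o wstar) + 2 * LR ^+ 2 * sqn (glob_model p W - wstar)))).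
    apply: le_fed_expect => // W.
    have -> : x - Rec o (glob_model p W) =
        (x - Rec o wstar) + - (Rec o (glob_model p W) - Rec o wstar).
      by rewrite opprB addrA addrNK.
    apply: le_trans (sqnD_young _ _ ltr01) _; rewrite invr1 sqnN.
    have := sqn_lipschitz (lip o (glob_model p W) wstar); lra.
  rewrite /fedavg_E fed_expectD fed_expect_cst // fed_expectZ lerD2l bE.
  by apply: ler_wpM2l => //; apply: mulr_ge0 => //; exact: sqr_ge0.
have mdist w : measurable_fun setT (fun o => sqn (x - Rec o w)).
  apply: measurable_sum => i; under eq_fun do rewrite !mxE.
  by apply: measurable_funM; apply: measurable_funB => //; exact: measurable_cst.
have mstar : measurable_fun setT (fun o => (2%:E * (sqn (x - Rec o wstar))%:E)%E).
  by apply: measurable_funeM; apply/measurable_EFinP; exact: mdist.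
apply: (@le_trans _ _ (\int[P]_o (2%:E * (sqn (x - Rec o wstar))%:E + b%:E))%E).
  apply: ge0_le_integral => //.
  - move=> o _; rewrite lee_fin.
    rewrite -[leLHS](fed_expect_cst D sgrad K E eta 1 t.-1 0 (fun=> w1) n0 p1).
    by apply: le_fed_expect => // W; exact: sqn_ge0.
  - by apply/measurable_EFinP; apply: measurable_fed_expect => W; exact: mdist.
  - by apply: emeasurable_funD => //; exact: measurable_cst.
  - by move=> o _; rewrite -EFinM -EFinD lee_fin; exact: pointwise.
(* The constant [b] integrates to itself because [P] has total mass 1. *)
rewrite ge0_integralD //.
- rewrite ge0_integralZl //.
  + rewrite (integral_cst P measurableT b%:E).
    suff -> : (b%:E * P setT = b%:E)%E by [].
    by transitivity (b%:E * 1)%E; [congr (_ * _)%E; exact: probability_setT | exact: mule1].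
  + by apply/measurable_EFinP; exact: mdist.
  + by move=> o _; rewrite lee_fin sqn_ge0.
- by move=> o _; rewrite -EFinM lee_fin mulr_ge0 ?sqn_ge0.
Qed.
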